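(* Let $E$ be a finite non-empty subset of $\Theta$, and let $0<\delta<\epsilon$. Assume $E\setminus S^\epsilon(E)\neq\emptyset$ and that there exist $b_1,b_2>0$ such that for every $t\in\mathbb R$ and all $\theta,\theta'\in E$: $$\mathcal M(\theta,\theta',t,Y)\le\exp\Big(\mathbb E[\Gamma(\theta,\theta',X,Y)\mid Y]\,t+\frac{b_1^2t^2}{2}\Big)\quad\text{a.s.},$$ $$\mathbb E\big[\exp\big(t\,\mathbb E[\Gamma(\theta,\theta',X,Y)\mid Y]\big)\big]\le\exp\Big(\mathbb E[\Gamma(\theta,\theta',X,Y)]\,t+\frac{b_2^2t^2}{2}\Big).$$ Then, for every $M,N\ge1$ and every hierarchical sample $(X^{k,l},Y^k)_{1\le k\le M,1\le l\le N}$ of $(X,Y)$, $$\mathbb P\big(\hat S^\delta_{M,N}(E)\not\subset S^\epsilon(E)\big)<|E|\exp\Big(\frac{-M(\epsilon-\delta)^2}{2(b_1^2/N+b_2^2)}\Big).$$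
   Context: $X$ and $Y$ are random variables with values in measurable spaces $\mathcal X$ and $\mathcal Y$. A hierarchical sample of size $M\times N$ of $(X,Y)$ consists of random variables $Y^1,\dots,Y^M$ and $X^{k,l}$, $1\le k\le M$, $1\le l\le N$, such that the blocks $(Y^k,X^{k,1},\dots,X^{k,N})$ are i.i.d. over $k$, each $Y^k$ has the law of $Y$, and, conditionally on $Y^k$, $X^{k,1},\dots,X^{k,N}$ are i.i.d. with the conditional law of $X$ given $Y=Y^k$. $\Theta\subset\mathbb R^d$ is a parameter set and $g:\Theta\times\mathcal X\times\mathcal Y\to\mathbb R$ is measurable with $g(\theta,X,Y)$ integrable for every $\theta$. Define $G(\theta)=\mathbb E[g(\theta,X,Y)]$ and $\hat G_{M,N}(\theta)=\frac1{MN}\sum_{k=1}^M\sum_{l=1}^N g(\theta,X^{k,l},Y^k)$. For $\epsilon>0$ and non-empty $E\subset\Theta$ (on which the minima below are attained), $S^\epsilon(E)=\{\theta\in E: G(\theta)\le\min_E G+\epsilon\}$ and $\hat S^\epsilon_{M,N}(E)=\{\theta\in E:\hat G_{M,N}(\theta)\le\min_E\hat G_{M,N}+\epsilon\}$. For $\theta,\theta'\in\Theta$, $t\in\mathbb R$, $y\in\mathcal Y$: $\Gamma(\theta,\theta',X,Y)=g(\theta',X,Y)-g(\theta,X,Y)$ and $\mathcal M(\theta,\theta',t,y)=\mathbb E[\exp(t\Gamma(\theta,\theta',X,Y))\mid Y=y]$. *)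

(* Defs.v *)
From HB Require Import structures.
From mathcomp Require Import all_boot all_order all_algebra.
From mathcomp Require Import finmap.
From mathcomp Require Import all_classical all_reals all_analysis.
Set Implicit Arguments. Unset Strict Implicit. Unset Printing Implicit Defensive.
Import Order.TTheory GRing.Theory Num.Theory.
Local Open Scope classical_set_scope.
Local Open Scope ring_scope.
Local Open Scope ereal_scope.

Definition is_cond_law d0 dx dy (Omega0 : measurableType d0)
  (TX : measurableType dx) (TY : measurableType dy) (R : realType)
  (P0 : probability Omega0 R) (X : Omega0 -> TX) (Y : Omega0 -> TY)
  (K : R.-pker TY ~> TX) : Prop :=
  forall (A : set TX) (B : set TY), measurable A -> measurable B ->
    P0 (X @^-1` A `&` Y @^-1` B) = \int[P0]_(w in Y @^-1` B) K (Y w) A.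

(* Hierarchical sample of size M x N of (X,Y) on the probability space P:
   the blocks (Ys k, Xs k 1, ..., Xs k N) are i.i.d. over k, Ys k has the law of Y,
   and conditionally on Ys k the Xs k l are i.i.d. with law K (Ys k).
   Expressed as: the joint law of all the variables agrees, on measurable
   rectangles, with the product over k of (law of Y) (x) K(y)^{(x) N}. *)
Definition hierarchical_sample d0 dx dy d (Omega0 : measurableType d0)
  (TX : measurableType dx) (TY : measurableType dy) (R : realType)
  (P0 : probability Omega0 R) (Y : Omega0 -> TY) (K : R.-pker TY ~> TX)
  (M N : nat) (Omega : measurableType d) (P : probability Omega R)
  (Ys : 'I_M -> Omega -> TY) (Xs : 'I_M -> 'I_N -> Omega -> TX) : Prop :=
  (forall k, measurable_fun setT (Ys k)) /\
  (forall k l, measurable_fun setT (Xs k l)) /\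
  forall (B : 'I_M -> set TY) (A : 'I_M -> 'I_N -> set TX),
    (forall k, measurable (B k)) -> (forall k l, measurable (A k l)) ->
    P (\bigcap_(k in [set: 'I_M])
         (Ys k @^-1` B k `&` \bigcap_(l in [set: 'I_N]) Xs k l @^-1` A k l))
    = \prod_(k < M) \int[P0]_(w in Y @^-1` B k) \prod_(l < N) K (Y w) (A k l).

Local Close Scope ereal_scope.

Definition Gfun d0 dx dy (Omega0 : measurableType d0)
  (TX : measurableType dx) (TY : measurableType dy) (R : realType) (Th : Type)
  (P0 : probability Omega0 R) (X : Omega0 -> TX) (Y : Omega0 -> TY)
  (g : Th -> TX -> TY -> R) (th : Th) : R :=
  Rintegral P0 setT (fun w => g th (X w) (Y w)).

Definition Ghat d dx dy (Omega : measurableType d)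
  (TX : measurableType dx) (TY : measurableType dy) (R : realType) (Th : Type)
  (M N : nat) (Ys : 'I_M -> Omega -> TY) (Xs : 'I_M -> 'I_N -> Omega -> TX)
  (g : Th -> TX -> TY -> R) (th : Th) (w : Omega) : R :=
  (M * N)%:R^-1 * \sum_(k < M) \sum_(l < N) g th (Xs k l w) (Ys k w).

Definition Gamma (R : realType) (Th TX TY : Type) (g : Th -> TX -> TY -> R)
  (th th' : Th) (x : TX) (y : TY) : R := g th' x y - g th x y.

Definition condE_Gamma dx dy (TX : measurableType dx) (TY : measurableType dy)
  (R : realType) (Th : Type) (K : R.-pker TY ~> TX) (g : Th -> TX -> TY -> R)
  (th th' : Th) (y : TY) : R :=
  Rintegral (K y) setT (fun x => Gamma g th th' x y).

Definition mgf_cond dx dy (TX : measurableType dx) (TY : measurableType dy)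
  (R : realType) (Th : Type) (K : R.-pker TY ~> TX) (g : Th -> TX -> TY -> R)
  (th th' : Th) (t : R) (y : TY) : \bar R :=
  (\int[K y]_x (expR (t * Gamma g th th' x y))%:E)%E.

(* eps-argmin set S^eps(E) of a function F over a finite set E:
   { theta in E : F theta <= min_E F + eps }, with min_E F written out. *)
Definition Seps (R : realType) (Th : choiceType) (F : Th -> R)
  (E : {fset Th}) (eps : R) : set Th :=
  [set th | th \in E /\ forall th', th' \in E -> F th <= F th' + eps].

(* Main.v *)
(* If the inclusion fails, some theta in E with G(theta) > G(theta') + eps for
   some theta' in E has sample mean of Gamma(theta, theta') at least -delta,
   while the mean of Gamma(theta, theta') is less than -eps. The Chernoff bound
   at the optimal t = M (a - mu) / (b1^2 / N + b2^2) controls each of these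
   events, and a union bound over theta concludes.

   The moment generating function of the sample mean is computed from the
   identity E [prod_(k,l) h_kl(X^kl, Y^k)] =
   prod_k E [prod_l E [h_kl(X, Y) | Y]] for nonnegative measurable h_kl. The law
   of the sample is only known on rectangles, so the identity is extended one
   index (k, l) at a time: with the other factors frozen, both sides are
   positive, additive and monotonically continuous in h_kl, so that the
   pi-lambda theorem passes from rectangles to measurable sets (where
   everything is finite), and simple functions pass from measurable sets to all nonnegative
   measurable functions. *)
Require Import Defs.
From HB Require Import structures.
From mathcomp Require Import all_boot all_order all_algebra.
From mathcomp Require Import finmap.
From mathcomp Require Import all_classical all_reals all_analysis.
From mathcomp Require Import measurable_realfun.
From mathcomp Require Import ring lra.
Import Order.TTheory GRing.Theory Num.Theory.
Local Open Scope classical_set_scope.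
Local Open Scope ring_scope.

Set Implicit Arguments.
Unset Strict Implicit.
Unset Printing Implicit Defensive.

(** * Nonnegative measurable functions and positive operators *)

Definition nnmeasurable d (T : measurableType d) (R : realType)
    (f : T -> \bar R) : Prop :=
  (forall x, 0 <= f x)%E /\ measurable_fun setT f.

(** These are the properties shared by integrals, kernels, substitutions and multiplications. Values
    are functions on [W] so that operators compose; a plain functional has [W = unit]. The field
    [posop_cvg] is monotone convergence, which lets values on indicators determine the operator. *)
Record positive_operator d1 d2 (T : measurableType d1) (W : measurableType d2)
    (R : realType) (S : (T -> \bar R) -> W -> \bar R) : Prop := {
  posop_nn : forall f, nnmeasurable f -> nnmeasurable (S f) ;
  posopD : forall f g, nnmeasurable f -> nnmeasurable g ->
    S (f \+ g)%E = (S f \+ S g)%E ;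
  posopZ : forall (c : R) f, (0 <= c)%R -> nnmeasurable f ->
    S (fun x => c%:E * f x)%E = (fun w => c%:E * S f w)%E ;
  posop_le : forall f g, nnmeasurable f -> nnmeasurable g ->
    (forall x, f x <= g x)%E -> forall w, (S f w <= S g w)%E ;
  posop_cvg : forall (u : (T -> \bar R)^nat) f,
    (forall n, nnmeasurable (u n)) ->
    (forall x, {homo u ^~ x : n m / (n <= m)%N >-> (n <= m)%E}) ->
    (forall x, u n x @[n --> \oo] --> f x) ->
    forall w, S (u n) w @[n --> \oo] --> S f w }.

Section nnmeasurable_theory.
Context d (T : measurableType d) (R : realType).
Local Open Scope ereal_scope.
Implicit Types f g : T -> \bar R.

Lemma nnmeasurableZ (c : R) f : (0 <= c)%R ->
  nnmeasurable f -> nnmeasurable (fun x => c%:E * f x).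
Proof.
move=> c0 [f0 mf]; split; last exact: measurable_funeM.
by move=> x; rewrite mule_ge0.
Qed.

Lemma nnmeasurableM f g :
  nnmeasurable f -> nnmeasurable g -> nnmeasurable (fun x => f x * g x).
Proof.
move=> [f0 mf] [g0 mg]; split; last exact: emeasurable_funM.
by move=> x; exact: mule_ge0.
Qed.

Lemma nnmeasurable_cst (c : \bar R) : 0 <= c -> nnmeasurable (fun _ : T => c).
Proof. by move=> c0; split. Qed.

Lemma nnmeasurable_indic (A : set T) :
  measurable A -> nnmeasurable (fun x => (\1_A x)%:E : \bar R).
Proof.
move=> mA; split; first by move=> x; rewrite lee_fin.
exact/measurable_EFinP.
Qed.

Lemma nnmeasurable_sum I (r : seq I) (u : I -> T -> \bar R) :
  (forall i, nnmeasurable (u i)) -> nnmeasurable (fun x => \sum_(i <- r) u i x).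
Proof.
move=> mu; split; first by move=> x; apply: sume_ge0 => i _; case: (mu i).
by apply: emeasurable_sum => i; case: (mu i).
Qed.

Lemma nnmeasurable_prod I (r : seq I) (P : pred I) (u : I -> T -> \bar R) :
  (forall i, nnmeasurable (u i)) ->
  nnmeasurable (fun x => \prod_(i <- r | P i) u i x).
Proof.
move=> mu; elim: r => [|i r IH].
  by under eq_fun do rewrite big_nil; exact: nnmeasurable_cst.
under eq_fun do rewrite big_cons.
by case: (P i) => //; exact: nnmeasurableM.
Qed.

Lemma nnmeasurable_comp d' (W : measurableType d') (Z : W -> T) f :
  measurable_fun setT Z -> nnmeasurable f -> nnmeasurable (f \o Z).
Proof.
by move=> mZ [f0 mf]; split; [move=> x /=|exact: measurableT_comp].
Qed.

End nnmeasurable_theory.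

(** * Examples and composition of positive operators *)

Section positive_operator_theory.
Local Open Scope ereal_scope.
Context (R : realType).

Lemma posop_comp d1 d2 d3 (T1 : measurableType d1) (T2 : measurableType d2)
    (T3 : measurableType d3) (S1 : (T1 -> \bar R) -> T2 -> \bar R)
    (S2 : (T2 -> \bar R) -> T3 -> \bar R) :
  positive_operator S1 -> positive_operator S2 ->
  positive_operator (fun f => S2 (S1 f)).
Proof.
move=> p1 p2; split.
- by move=> f nf; exact/(posop_nn p2)/(posop_nn p1).
- move=> f g nf ng.
  by rewrite (posopD p1)// (posopD p2)//; exact: posop_nn p1 _ _.
- move=> c f c0 nf.
  by rewrite (posopZ p1)// (posopZ p2)//; exact: posop_nn p1 _ _.
- move=> f g nf ng fg w; apply: (posop_le p2); first exact: posop_nn p1 _ _.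
  + exact: posop_nn p1 _ _.
  + exact: posop_le p1 _ _ nf ng fg.
- move=> u f nu uhomo uf w; apply: (posop_cvg p2).
  + by move=> n; exact: posop_nn p1 _ _.
  + move=> x n m nm; apply: (posop_le p1) => // y; exact: uhomo.
  + exact: posop_cvg p1 _ _ nu uhomo uf.
Qed.

Lemma posop_precomp d1 d2 (T : measurableType d1) (W : measurableType d2)
    (Z : W -> T) : measurable_fun setT Z ->
  positive_operator (fun (f : T -> \bar R) w => f (Z w)).
Proof.
move=> mZ; split => //.
by move=> f; exact: nnmeasurable_comp.
Qed.

(** Multiplication is continuous on the extended reals except at products of zero and infinity. If
    [l = 0], monotonicity and nonnegativity force every [u n] to be 0; if [D = 0], both sides
    vanish. An infinite [D] is thus allowed, as multipliers may be infinite. *)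
Lemma nd_cvgeMr (u : (\bar R)^nat) (l D : \bar R) : (forall n, 0 <= u n) ->
  {homo u : n m / (n <= m)%N >-> (n <= m)%E} -> 0 <= D ->
  u n @[n --> \oo] --> l -> u n * D @[n --> \oo] --> l * D.
Proof.
move=> u0 uhomo D0 ul; have [l0|l0] := eqVneq l 0.
  have un0 n : u n = 0.
    apply/eqP; rewrite eq_le u0 andbT -l0 -(cvg_lim _ ul)//.
    apply: lime_ge; first by apply/cvg_ex; exists l.
    by near=> m; apply: uhomo; near: m; exists n.
  under eq_fun do rewrite un0 mul0e.
  by rewrite l0 mul0e; exact: cvg_cst.
have [->|DN0] := eqVneq D 0.
  by rewrite mule0; under eq_fun do rewrite mule0; exact: cvg_cst.
apply: cvgeM => //; last exact: cvg_cst.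
by case: l D l0 DN0 {D0 ul} => [r| |] [s| |].
Unshelve. all: by end_near. Qed.

Lemma posop_mul d (T : measurableType d) (D : T -> \bar R) :
  nnmeasurable D ->
  positive_operator (fun (f : T -> \bar R) x => f x * D x).
Proof.
move=> nD; have D0 := nD.1; split.
- by move=> f nf; exact: nnmeasurableM.
- move=> f g [f0 _] [g0 _]; apply/funext => x /=.
  by rewrite ge0_muleDl.
- by move=> c f _ _; apply/funext => x /=; rewrite muleA.
- by move=> f g _ _ fg w; rewrite lee_wpmul2r.
- move=> u f nu uhomo uf w; apply: nd_cvgeMr => //.
  by move=> n; case: (nu n).
Qed.

Lemma cvg_monotone_convergence_to d (T : measurableType d)
    (mu : {measure set T -> \bar R}) (u : (T -> \bar R)^nat) f :
  (forall n, nnmeasurable (u n)) ->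
  (forall x, {homo u ^~ x : n m / (n <= m)%N >-> (n <= m)%E}) ->
  (forall x, u n x @[n --> \oo] --> f x) ->
  \int[mu]_x u n x @[n --> \oo] --> \int[mu]_x f x.
Proof.
move=> nu uhomo uf.
rewrite [X in _ --> X](_ : _ = \int[mu]_x limn (u ^~ x)); last first.
  by apply: eq_integral => x _; apply/esym/cvg_lim => //; exact: uf.
by apply: cvg_monotone_convergence => // n; case: (nu n) => // u0 _ x _.
Qed.

Lemma posop_integral d (T : measurableType d)
    (mu : {measure set T -> \bar R}) :
  positive_operator (fun (f : T -> \bar R) (_ : unit) => \int[mu]_x f x).
Proof.
split.
- by move=> f [f0 mf]; apply: nnmeasurable_cst; exact: integral_ge0.
- by move=> f g [f0 mf] [g0 mg]; apply/funext => _; rewrite /= ge0_integralD.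
- move=> c f c0 [f0 mf]; apply/funext => _.
  by rewrite /= ge0_integralZl_EFin.
- by move=> f g [f0 mf] [g0 mg] fg _; exact: ge0_le_integral.
- by move=> u f nu uhomo uf _; exact: cvg_monotone_convergence_to.
Qed.

Lemma posop_kernel dx dy (TX : measurableType dx) (TY : measurableType dy)
    (K : R.-pker TY ~> TX) :
  positive_operator
    (fun (f : TX * TY -> \bar R) y => \int[K y]_x f (x, y)).
Proof.
have nnpair (f : TX * TY -> \bar R) y :
    nnmeasurable f -> nnmeasurable (fun x => f (x, y)).
  by move=> [f0 mf]; split => [x //|]; exact: measurable_fun_pair1.
split.
- move=> f nf; split; first by move=> y; apply: integral_ge0 => x _; case: nf.
  (* The measurability lemma for kernels takes the parameter [y] as first coordinate, hence the
     swap. *)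
  apply: (measurable_fun_integral_sfinite_kernel (fun yx => f (yx.2, yx.1)) K).
    by move=> t; case: nf.
  case: nf => _ mf.
  apply: (measurableT_comp mf).
  by apply: measurable_fun_pair; [exact: measurable_snd|exact: measurable_fst].
- move=> f g nf ng; apply/funext => y /=.
  by case: (nnpair _ y nf) (nnpair _ y ng) => ? ? [? ?]; rewrite ge0_integralD.
- move=> c f c0 nf; apply/funext => y /=.
  by case: (nnpair _ y nf) => ? ?; rewrite ge0_integralZl_EFin.
- move=> f g nf ng fg y.
  case: (nnpair _ y nf) (nnpair _ y ng) => ? ? [? ?].
  exact: ge0_le_integral.
- move=> u f nu uhomo uf y.
  apply: cvg_monotone_convergence_to => [n|x|x]; first exact: nnpair.
    exact: uhomo.
  exact: uf.
Qed.

(** * Agreement of two positive operators *)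

Section agreement.
Context d1 d2 (T : measurableType d1) (W : measurableType d2).
Variables S1 S2 : (T -> \bar R) -> W -> \bar R.
Hypotheses (p1 : positive_operator S1) (p2 : positive_operator S2).
Implicit Types (f : T -> \bar R) (w : W).

Lemma posop_eq_sum (w : W) I (r : seq I) (u : I -> T -> \bar R) :
  (forall i, nnmeasurable (u i)) -> (forall i, S1 (u i) w = S2 (u i) w) ->
  S1 (fun x => \sum_(i <- r) u i x) w = S2 (fun x => \sum_(i <- r) u i x) w.
Proof.
move=> nu Su; elim: r => [|i r IH].
  (* That an operator sends 0 to 0 is homogeneity with the scalar 0. *)
  have z0 : (fun x => \sum_(i <- [::]) u i x) =
      (fun x : T => 0%:E * (cst (0 : \bar R)) x).
    by apply/funext => x; rewrite big_nil mul0e.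
  by rewrite z0 (posopZ p1)// ?(posopZ p2)// ?mul0e//; exact: nnmeasurable_cst.
have -> : (fun x => \sum_(j <- i :: r) u j x) =
    u i \+ (fun x => \sum_(j <- r) u j x).
  by apply/funext => x; rewrite big_cons.
have ns : nnmeasurable (fun x => \sum_(j <- r) u j x).
  exact: nnmeasurable_sum.
by rewrite (posopD p1)// (posopD p2)// IH Su.
Qed.

Lemma posop_eq_cvg (w : W) (u : (T -> \bar R)^nat) f :
  (forall n, nnmeasurable (u n)) ->
  (forall x, {homo u ^~ x : n m / (n <= m)%N >-> (n <= m)%E}) ->
  (forall x, u n x @[n --> \oo] --> f x) ->
  (forall n, S1 (u n) w = S2 (u n) w) -> S1 f w = S2 f w.
Proof.
move=> nu uhomo uf Su.
have c1 := posop_cvg p1 nu uhomo uf (w := w).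
have c2 := posop_cvg p2 nu uhomo uf (w := w).
rewrite -(cvg_lim _ c1)// -(cvg_lim _ c2)//.
by under eq_fun do rewrite Su.
Qed.

(** The sets on whose indicators the operators agree form a Dynkin system: complements use
    additivity and subtraction, which is why the value at 1 is assumed finite, and disjoint unions
    use monotone convergence. *)
Lemma posop_eq_sigma_algebra (w : W) (G : set (set T)) :
  measurable = <<s G >> -> setI_closed G -> G setT ->
  S1 (cst 1) w < +oo ->
  (forall A, G A -> S1 (EFin \o \1_A) w = S2 (EFin \o \1_A) w) ->
  forall A, measurable A -> S1 (EFin \o \1_A) w = S2 (EFin \o \1_A) w.
Proof.
move=> mG GI GT fin SG; rewrite mG.
have ST : S1 (cst 1) w = S2 (cst 1) w.
  by have := SG _ GT; rewrite indicT.
apply: (dynkin_induction mG) => //; first exact: SG.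
  move=> A mA SA.
  have E : cst 1 = (EFin \o \1_A) \+ (EFin \o \1_(~` A)) :> (T -> \bar R).
    apply/funext => x /=; rewrite indicC indicE.
    by case: (x \in A); rewrite /= ?adde0 ?add0e.
  have nA : nnmeasurable (EFin \o \1_A : T -> \bar R).
    exact: nnmeasurable_indic.
  have nCA : nnmeasurable (EFin \o \1_(~` A) : T -> \bar R).
    by apply: nnmeasurable_indic; exact: measurableC.
  have e1 : S1 (cst 1) w = S1 (EFin \o \1_A) w + S1 (EFin \o \1_(~` A)) w.
    by rewrite E (posopD p1).
  have e2 : S2 (cst 1) w = S2 (EFin \o \1_A) w + S2 (EFin \o \1_(~` A)) w.
    by rewrite E (posopD p2).
  (* Finiteness makes it legitimate to cancel the contribution of [A] from the total. *)
  have fA : S1 (EFin \o \1_A) w \is a fin_num.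
    rewrite ge0_fin_numE; last by case: (posop_nn p1 nA).
    apply: le_lt_trans fin; rewrite e1 leeDl//.
    by case: (posop_nn p1 nCA).
  rewrite -[LHS](addeK _ fA) -[RHS](addeK _ fA) [X in X - _ = _]addeC.
  rewrite -e1 ST e2; congr (_ - _).
  by rewrite SA addeC.
move=> F mF tF SF.
(* By disjointness, the indicator of the union is the increasing limit of the partial sums of
   indicators. *)
apply: (@posop_eq_cvg w (fun n x => \sum_(0 <= i < n) (\1_(F i) x)%:E)).
- by move=> n; apply: nnmeasurable_sum => i; exact: nnmeasurable_indic.
- by move=> x; apply: ereal_nondecreasing_series => n _ _; rewrite lee_fin.
- move=> x; rewrite /= indic_bigcup//; apply: is_cvg_nneseries => n _ _.
  by rewrite lee_fin.
- move=> n; apply: posop_eq_sum => i; last exact: SF.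
  exact: nnmeasurable_indic.
Qed.

Import HBNNSimple.

Lemma posop_eq_nnmeasurable (w : W) :
  (forall A, measurable A ->
    S1 (EFin \o \1_A) w = S2 (EFin \o \1_A) w) ->
  forall f, nnmeasurable f -> S1 f w = S2 f w.
Proof.
move=> SA f [f0 mf]; pose f_ := nnsfun_approx measurableT mf.
apply: (@posop_eq_cvg w (fun n x => (f_ n x)%:E)).
- by move=> n; split; [move=> x; rewrite lee_fin|exact/measurable_EFinP].
- by move=> x m n mn; rewrite lee_fin; exact/lefP/nd_nnsfun_approx.
- by move=> x; exact: cvg_nnsfun_approx.
move=> n.
pose u r x := r%:E * (\1_(f_ n @^-1` [set r]) x)%:E.
have -> : (fun x => (f_ n x)%:E) =
    (fun x => \sum_(r <- fset_set (range (f_ n))) u r x).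
  apply/funext => x; rewrite fimfunE fsbig_finite//= -sumEFin.
  by apply: eq_bigr => r _; rewrite EFinM.
have mA r : measurable (f_ n @^-1` [set r]) by exact: measurable_funPTI.
have nA r : nnmeasurable (EFin \o \1_(f_ n @^-1` [set r]) : T -> \bar R).
  exact: nnmeasurable_indic.
(* The sum ranges over arbitrary reals [r], while homogeneity needs a nonnegative scalar. For
   negative [r] the level set is empty, so the scalar can be replaced by 0. *)
have u0 r : (r < 0)%R ->
    u r = fun x => 0%:E * (EFin \o \1_(f_ n @^-1` [set r])) x.
  move=> r0; apply/funext => x.
  by rewrite /u preimage_nnfun0// indic0 /= mule0 mul0e.
apply: posop_eq_sum => r; have [r0|r0] := leP 0%R r.
- exact: (nnmeasurableZ r0 (nA r)).
- by rewrite u0//; exact: nnmeasurableZ (nA r).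
- by rewrite /u (posopZ p1 r0 (nA r)) (posopZ p2 r0 (nA r)) SA.
- by rewrite u0// (posopZ p1 _ (nA r))// (posopZ p2 _ (nA r))// SA.
Qed.

End agreement.

End positive_operator_theory.

(** The entries are released from [A] to [B] one at a time. It serves twice: from rectangles to
    measurable sets, then from indicators to nonnegative measurable functions. *)
Lemma family_extension (I : finType) (F : Type) (A B : F -> Prop)
    (Q : (I -> F) -> Prop) :
  (forall f, A f -> B f) ->
  (forall h, (forall i, A (h i)) -> Q h) ->
  (forall i h, (forall j, B (h j)) ->
    (forall f, A f -> Q [eta h with i |-> f]) ->
    forall f, B f -> Q [eta h with i |-> f]) ->
  forall h, (forall i, B (h i)) -> Q h.
Proof.
move=> AB QA step.
(* [s] lists the indices whose entry may lie outside [A]; it starts as all of [I] and shrinks to the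
   empty list. *)
suff main (s : seq I) h :
    (forall i, i \notin s -> A (h i)) -> (forall i, B (h i)) -> Q h.
  by move=> h hB; apply: (main (enum I)) => // i; rewrite mem_enum.
elim: s h => [|i s IH] h hA hB; first by apply: QA => i; exact: hA.
have -> : h = [eta h with i |-> h i].
  by apply/funext => j /=; case: eqVneq => [->|].
apply: step => // f Af; apply: IH => j /=.
  move=> js; case: eqVneq => // ji; apply: hA.
  by rewrite inE negb_or ji.
by case: eqVneq => // _; exact: AB.
Qed.

(** * Integrals of products over a hierarchical sample *)

Section hierarchical.
Local Open Scope ereal_scope.
Context (R : realType) d0 dx dy d (Omega0 : measurableType d0)
  (TX : measurableType dx) (TY : measurableType dy)
  (P0 : probability Omega0 R) (Y : Omega0 -> TY) (K : R.-pker TY ~> TX)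
  (M N : nat) (Omega : measurableType d) (P : probability Omega R)
  (Ys : 'I_M -> Omega -> TY) (Xs : 'I_M -> 'I_N -> Omega -> TX).
Hypothesis mY : measurable_fun setT Y.
Hypothesis hs : hierarchical_sample P0 Y K P Ys Xs.

Let T := (TX * TY)%type.
Let I := ('I_M * 'I_N)%type.

Let Z (p : I) (w : Omega) : T := (Xs p.1 p.2 w, Ys p.1 w).

(** This plays the part of the conditional expectation of [f (X, Y)] given [Y]. *)
Let kint (f : T -> \bar R) (w : Omega0) : \bar R := \int[K (Y w)]_x f (x, Y w).

Let sample_side (h : I -> T -> \bar R) : \bar R :=
  \int[P]_w \prod_p h p (Z p w).

Let law_side (h : I -> T -> \bar R) : \bar R :=
  \prod_(k < M) \int[P0]_w \prod_(l < N) kint (h (k, l)) w.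

Let mZ p : measurable_fun setT (Z p).
Proof. by case: hs => mYs [mXs _]; exact: measurable_fun_pair. Qed.

Let posop_kint : positive_operator kint.
Proof. exact: posop_comp (posop_kernel K) (posop_precomp R mY). Qed.

(** [sample_side] as a function of its entry at [p] alone, the other entries being frozen at [h];
    [law_coord] does the same for [law_side]. The [unit] argument gives both the shape of a positive
    operator. *)
Let sample_coord (h : I -> T -> \bar R) (p : I) (f : T -> \bar R)
    (_ : unit) : \bar R :=
  \int[P]_w (f (Z p w) * \prod_(q | q != p) h q (Z q w)).

Let law_coord (h : I -> T -> \bar R) (p : I) (f : T -> \bar R)
    (_ : unit) : \bar R :=
  (\int[P0]_w (kint f w * \prod_(l < N | l != p.2) kint (h (p.1, l)) w)) *
  \prod_(k < M | k != p.1) \int[P0]_w \prod_(l < N) kint (h (k, l)) w.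

Let posop_sample_coord h p : (forall q, nnmeasurable (h q)) ->
  positive_operator (sample_coord h p).
Proof.
move=> nh.
apply: (posop_comp (S2 := fun (f : Omega -> \bar R) (_ : unit) =>
   \int[P]_w (f w * \prod_(q | q != p) h q (Z q w))) (posop_precomp R (mZ p))).
apply: (posop_comp (posop_mul _) (posop_integral P)).
by apply: nnmeasurable_prod => q; exact: (nnmeasurable_comp (mZ q)).
Qed.

Let posop_law_coord h p : (forall q, nnmeasurable (h q)) ->
  positive_operator (law_coord h p).
Proof.
move=> nh.
have nk q : nnmeasurable (kint (h q)) by exact: posop_nn posop_kint _ _.
set c := fun _ : unit =>
  \prod_(k < M | k != p.1) \int[P0]_w \prod_(l < N) kint (h (k, l)) w.
have nc : nnmeasurable c.
  apply: nnmeasurable_cst; apply: prode_ge0 => k _; apply: integral_ge0 => w _.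
  by apply: prode_ge0 => l _; case: (nk (k, l)).
apply: (posop_comp (S2 := fun (f : unit -> \bar R) t => f t * c t)
  (S1 := fun f (_ : unit) => \int[P0]_w (kint f w *
    \prod_(l < N | l != p.2) kint (h (p.1, l)) w)));
  last exact: posop_mul.
apply: (posop_comp (S2 := fun (f : Omega0 -> \bar R) (_ : unit) =>
  \int[P0]_w (f w * \prod_(l < N | l != p.2) kint (h (p.1, l)) w)) posop_kint).
apply: (posop_comp (posop_mul _) (posop_integral P0)).
by apply: nnmeasurable_prod => l; exact: nk.
Qed.

Let sample_sideE h p f :
  sample_side [eta h with p |-> f] = sample_coord h p f tt.
Proof.
apply: eq_integral => w _; rewrite (bigD1 p)//= eqxx; congr (_ * _).
by apply: eq_bigr => q /negbTE ->.
Qed.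

Let law_sideE h p f : law_side [eta h with p |-> f] = law_coord h p f tt.
Proof.
case: p => k0 l0; rewrite /law_side /law_coord (bigD1 k0)//=; congr (_ * _).
  apply: eq_integral => w _; rewrite (bigD1 l0)//= eqxx; congr (_ * _).
  by apply: eq_bigr => l /negbTE ll0; rewrite xpair_eqE ll0 andbF.
apply: eq_bigr => k /negbTE kk0; apply: eq_integral => w _.
by apply: eq_bigr => l _; rewrite xpair_eqE kk0.
Qed.

Let rect (f : T -> \bar R) := exists A B,
  [/\ measurable A, measurable B & f = EFin \o \1_(A `*` B)].

Let mindicator (f : T -> \bar R) := exists2 C, measurable C & f = EFin \o \1_C.

Let indicX (A : set TX) (B : set TY) x y :
  (\1_(A `*` B) (x, y) = \1_A x * \1_B y :> R)%R.
Proof. by rewrite !indicE in_setX /= -natrM mulnb. Qed.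

(** A product of indicators of rectangles is the indicator of an event of the kind whose probability
    [hierarchical_sample] prescribes. *)
Let sample_law_rect h : (forall p, rect (h p)) -> sample_side h = law_side h.
Proof.
move=> hr.
have /choice[A hA] : forall p, exists A, exists B,
  [/\ measurable A, measurable B & h p = EFin \o \1_(A `*` B)].
  by move=> p; have [A [B ?]] := hr p; exists A, B.
have {hA} /choice[B hAB] := hA.
have [mYs [mXs law]] := hs.
(* The variables of block [k] share one [Ys k], so the [N] conditions on it merge into an
   intersection. *)
pose Bk k := \bigcap_(l in [set: 'I_N]) B (k, l).
have mBk k : measurable (Bk k).
  by apply: fin_bigcap_measurable => // l _; have [] := hAB (k, l).
have mA k l : measurable (A (k, l)) by have [] := hAB (k, l).
have := law Bk (fun k l => A (k, l)) mBk mA.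
set S := \bigcap_(k in _) _ => PS.
have mS : measurable S.
  apply: fin_bigcap_measurable => // k _; apply: measurableI.
    by rewrite -[X in measurable X]setTI; exact: mYs.
  apply: fin_bigcap_measurable => // l _.
  by rewrite -[X in measurable X]setTI; exact: mXs.
transitivity (P S).
  rewrite -[in RHS](setIT S) -integral_indic//; apply: eq_integral => w _.
  transitivity ((\prod_p \1_(A p `*` B p) (Z p w))%:E : \bar R).
    by rewrite -prodEFin; apply: eq_bigr => p _; have [_ _ ->] := hAB p.
  congr EFin; rewrite indicE; have [wS|/negP wS] := boolP (w \in S).
    rewrite big1// => -[k l] _; rewrite indicE mem_set//=.
    move: wS; rewrite inE => /(_ k Logic.I)[/= wB wA]; split.
      exact: (wA l).
    exact: (wB l).
  apply/eqP; rewrite prodf_seq_eq0; apply: contra_notT wS => /hasPn wN.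
  rewrite inE => k _; have hin l : (A (k, l) `*` B (k, l)) (Z (k, l) w).
    have := wN (k, l); rewrite mem_index_enum => /(_ isT) /=.
    by rewrite indicE; case: (boolP (_ \in _)) => [/set_mem//|]; rewrite eqxx.
  by split => l _ /=; have [] := hin l.
rewrite PS; apply: eq_bigr => k _.
rewrite integral_mkcond; apply: eq_integral => w _; rewrite patchE.
have kE l : kint (h (k, l)) w = K (Y w) (A (k, l)) * (\1_(B (k, l)) (Y w))%:E.
  have [mA' mB' ->] := hAB (k, l); rewrite /kint.
  under eq_integral do rewrite /= indicX EFinM.
  rewrite ge0_integralZr//; last exact/measurable_EFinP.
  by rewrite integral_indic// setIT.
under [RHS]eq_bigr do rewrite kE.
(* Inside [Bk k] every indicator in [Y w] equals 1; outside, one of them vanishes and kills the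
   product. *)
case: ifPn => [|wN].
  rewrite inE => wB; apply: eq_bigr => l _.
  by rewrite indicE mem_set ?mule1//; exact: (wB l Logic.I).
have [l lN] : exists l, ~ B (k, l) (Y w).
  apply/existsNP => wB; move/negP: wN; apply; rewrite inE => l _; exact: wB.
by rewrite (bigD1 l)//= indicE memNset// mule0 mul0e.
Qed.

Let sample_law_indic h :
  (forall p, mindicator (h p)) -> sample_side h = law_side h.
Proof.
move: h; apply: (@family_extension _ _ rect mindicator).
- move=> _ [A [B [mA mB ->]]]; exists (A `*` B) => //; exact: measurableX.
- exact: sample_law_rect.
move=> p h hB hrect _ [C mC ->].
have nh q : nnmeasurable (h q).
  by have [D mD ->] := hB q; exact: nnmeasurable_indic.
rewrite sample_sideE law_sideE.
apply: (posop_eq_sigma_algebra (posop_sample_coord p nh) (posop_law_coord p nh)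
  (measurable_prod_measurableType TX TY)) => //.
- move=> _ _ [X1 mX1 [X2 mX2 <-]] [Y1 mY1 [Y2 mY2 <-]].
  exists (X1 `&` Y1); first exact: measurableI.
  by exists (X2 `&` Y2); [exact: measurableI|rewrite setXI].
- by exists setT => //; exists setT => //; rewrite setXTT.
- rewrite /sample_coord; apply: (@le_lt_trans _ _ (\int[P]_w (cst 1 w))).
    apply: ge0_le_integral => //.
    + by move=> w _; rewrite mul1e; apply: prode_ge0 => q _; case: (nh q).
    + under eq_fun do rewrite mul1e.
      have [//|_] := nnmeasurable_prod (index_enum I) (fun q => q != p)
        (u := fun q w => h q (Z q w)); last by [].
      by move=> q; exact: (nnmeasurable_comp (mZ q)).
    + move=> w _; rewrite mul1e.
      suff /andP[] : 0 <= \prod_(q | q != p) h q (Z q w) <= 1 by [].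
      elim/big_ind : _ => [|x y /andP[x0 x1] /andP[y0 y1]|q _].
      * by rewrite lexx lee01.
      * by rewrite mule_ge0//= -[leRHS]mule1 lee_pmul.
      * have [D mD ->] := hB q.
        by rewrite /= !lee_fin indicE ler0n lern1 leq_b1.
  by rewrite integral_cst// mul1e (le_lt_trans (probability_le1 P _)) ?ltry.
- move=> _ [A mA [B mB <-]]; rewrite -sample_sideE -law_sideE.
  by apply: hrect; exists A, B.
Qed.

(** Passing from indicators to functions uses only linear combinations and monotone limits, so both
    sides may be infinite. *)
Lemma hierarchical_integral (h : I -> T -> \bar R) :
  (forall p, nnmeasurable (h p)) ->
  \int[P]_w \prod_p h p (Xs p.1 p.2 w, Ys p.1 w) =
  \prod_(k < M) \int[P0]_w \prod_(l < N) \int[K (Y w)]_x h (k, l) (x, Y w).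
Proof.
move: h; apply: (@family_extension _ _ mindicator (@nnmeasurable _ T R)).
- by move=> _ [C mC ->]; exact: nnmeasurable_indic.
- exact: sample_law_indic.
move=> p h nh hind f nf.
rewrite -/(sample_side _) -/(law_side _) sample_sideE law_sideE.
apply: (posop_eq_nnmeasurable (posop_sample_coord p nh) (posop_law_coord p nh))
  nf => C mC.
by rewrite -sample_sideE -law_sideE; apply: hind; exists C.
Qed.

End hierarchical.

(** * Products, unions and measurability of conditional means *)

Section measure_bounds.
Local Open Scope ereal_scope.
Context (R : realType).

Lemma lee_prod I (r : seq I) (f g : I -> \bar R) :
  (forall i, 0 <= f i) -> (forall i, f i <= g i) ->
  \prod_(i <- r) f i <= \prod_(i <- r) g i.
Proof.
move=> f0 fg; elim: r => [|i r IH]; first by rewrite !big_nil.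
by rewrite !big_cons lee_pmul//; exact: prode_ge0.
Qed.

Lemma prode_expR_const n (x : R) :
  \prod_(i < n) (expR x)%:E = (expR (n%:R * x))%:E.
Proof. by rewrite prodEFin prodr_const card_ord expRM_natl. Qed.

Lemma union_bound d (T : measurableType d) (mu : {measure set T -> \bar R})
    (I : Type) (r : seq I) (A : I -> set T) :
  (forall i, measurable (A i)) ->
  mu (\big[setU/set0]_(i <- r) A i) <= \sum_(i <- r) mu (A i).
Proof.
move=> mA; elim: r => [|i r IH]; first by rewrite !big_nil measure0.
rewrite !big_cons; apply: le_trans (leeD2l _ IH).
by apply: measureU2 => //; exact: bigsetU_measurable.
Qed.

(** [posop_kernel] handles nonnegative functions, so the integral is split into positive and
    negative parts; [fine], which sends infinite values to 0, is measurable. *)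
Lemma measurable_Rintegral_kernel dx dy (TX : measurableType dx)
    (TY : measurableType dy) (K : R.-pker TY ~> TX) (f : TX * TY -> R) :
  measurable_fun setT f ->
  measurable_fun setT (fun y => Rintegral (K y) setT (fun x => f (x, y))).
Proof.
move=> mf; apply: measurableT_comp; first exact: fine_measurable.
have mEf : measurable_fun setT (EFin \o f) by exact/measurable_EFinP.
under eq_fun do rewrite integralE.
apply: emeasurable_funB.
  have nn : nnmeasurable (EFin \o f)^\+.
    by split; [exact: funepos_ge0|exact: measurable_funepos].
  have [_] := posop_nn (posop_kernel K) nn; apply: eq_measurable_fun => y _.
  by apply: eq_integral => x _; rewrite !funeposE.
have nn : nnmeasurable (EFin \o f)^\-.
  by split; [exact: funeneg_ge0|exact: measurable_funeneg].
have [_] := posop_nn (posop_kernel K) nn; apply: eq_measurable_fun => y _.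
  by apply: eq_integral => x _; rewrite !funenegE.
Qed.

End measure_bounds.

(** * Chernoff bound for the sample mean of [c], with conditional mean [m] and mean [mu] *)

Section hierarchical_concentration.
Context (R : realType) d0 dx dy d (Omega0 : measurableType d0)
  (TX : measurableType dx) (TY : measurableType dy)
  (P0 : probability Omega0 R) (Y : Omega0 -> TY) (K : R.-pker TY ~> TX)
  (M N : nat) (Omega : measurableType d) (P : probability Omega R)
  (Ys : 'I_M -> Omega -> TY) (Xs : 'I_M -> 'I_N -> Omega -> TX).
Hypothesis mY : measurable_fun setT Y.
Hypothesis hs : hierarchical_sample P0 Y K P Ys Xs.
Variables (c : TX -> TY -> R) (m : TY -> R) (mu b1 b2 : R).
Hypothesis mc : measurable_fun setT (fun p : TX * TY => c p.1 p.2).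
Hypothesis mm : measurable_fun setT m.
Hypothesis cond_mgf : forall t, {ae P0, forall w,
  (\int[K (Y w)]_x (expR (t * c x (Y w)))%:E <=
   (expR (m (Y w) * t + b1 ^+ 2 * t ^+ 2 / 2))%:E)%E}.
Hypothesis mean_mgf : forall t,
  (\int[P0]_w (expR (t * m (Y w)))%:E <=
   (expR (mu * t + b2 ^+ 2 * t ^+ 2 / 2))%:E)%E.

(** The exponential of the sum is a product, so the blocks separate. In each block, [cond_mgf] at
    [s] is used [N] times; what remains is the exponential of [N s m(Y)], bounded by [mean_mgf] at
    [N s]. *)
Lemma hierarchical_mgf_le (s : R) :
  (\int[P]_w (expR (s * \sum_(k < M) \sum_(l < N) c (Xs k l w) (Ys k w)))%:E <=
   (expR (M%:R * (N%:R * (b1 ^+ 2 * s ^+ 2 / 2)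
     + (mu * (N%:R * s) + b2 ^+ 2 * (N%:R * s) ^+ 2 / 2))))%:E)%E.
Proof.
pose e (z : TX * TY) : \bar R := (expR (s * c z.1 z.2))%:E.
have ne : nnmeasurable e.
  split; first by move=> z; rewrite lee_fin expR_ge0.
  apply/measurable_EFinP; apply: measurableT_comp => //.
  exact: measurable_funM.
have nk : nnmeasurable
    (fun w => \int[K (Y w)]_x (expR (s * c x (Y w)))%:E)%E.
  exact: (nnmeasurable_comp mY (posop_nn (posop_kernel K) ne)).
under eq_integral => w _.
  rewrite pair_bigA mulr_sumr expR_sum -prodEFin.
  over.
rewrite [leLHS](hierarchical_integral mY hs (h := fun=> e) (fun=> ne)).
rewrite -prode_expR_const.
apply: lee_prod => k.
  by apply: integral_ge0 => w _; apply: prode_ge0 => l _; case: nk.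
apply: (@le_trans _ _ (\int[P0]_w ((expR (N%:R * (b1 ^+ 2 * s ^+ 2 / 2)))%:E *
    (expR (N%:R * s * m (Y w)))%:E))%E).
  apply: ae_ge0_le_integral => //.
  - by move=> w _; apply: prode_ge0 => l _; case: nk.
  - by case: (nnmeasurable_prod (index_enum 'I_N) xpredT (fun=> nk)).
  - apply: measurable_funeM; apply/measurable_EFinP.
    apply: measurableT_comp => //.
    by apply: measurable_funM => //; exact: measurableT_comp.
  apply: filterS (cond_mgf s) => w hw _.
  rewrite -EFinM -expRD.
  have -> : (N%:R * (b1 ^+ 2 * s ^+ 2 / 2) + N%:R * s * m (Y w) =
      N%:R * (m (Y w) * s + b1 ^+ 2 * s ^+ 2 / 2) :> R)%R by ring.
  rewrite -prode_expR_const; apply: lee_prod => // l; first by case: nk.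
rewrite ge0_integralZl_EFin ?expR_ge0//.
(* The remaining integral is bounded by [mean_mgf] at [N s]. *)
- by rewrite expRD EFinM lee_pmul2l// ?lte_fin ?expR_gt0//.
- apply/measurable_EFinP; apply: measurableT_comp => //.
  by apply: measurable_funM => //; exact: measurableT_comp.
Qed.

Let sample_mean w :=
  (M * N)%:R^-1 * \sum_(k < M) \sum_(l < N) c (Xs k l w) (Ys k w).

Lemma measurable_sample_mean : measurable_fun setT sample_mean.
Proof.
have [mYs [mXs _]] := hs.
apply: measurable_funM => //; apply: measurable_sum => k.
apply: measurable_sum => l.
rewrite -[X in measurable_fun _ X]/((fun p : TX * TY => c p.1 p.2) \o
  (fun w => (Xs k l w, Ys k w))).
by apply: measurableT_comp => //; exact: measurable_fun_pair.
Qed.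

Lemma sample_mean_tail (a : R) : (0 < M)%N -> (0 < N)%N -> 0 < b1 -> 0 < b2 ->
  mu <= a ->
  (P [set w | (a <= sample_mean w)%R] <=
   (expR (- (M%:R * (a - mu) ^+ 2) / (2 * (b1 ^+ 2 / N%:R + b2 ^+ 2))))%:E)%E.
Proof.
move=> M0 N0 b10 b20 mua.
have MR : 0 < M%:R :> R by rewrite ltr0n.
have NR : 0 < N%:R :> R by rewrite ltr0n.
set v := b1 ^+ 2 / N%:R + b2 ^+ 2.
have v0 : 0 < v by rewrite addr_gt0// ?divr_gt0// exprn_gt0.
(* This minimizes the exponent [- t a + t mu + t^2 v / (2 M)], with minimum
   [- M (a - mu)^2 / (2 v)]. *)
pose t := M%:R * (a - mu) / v.
have t0 : 0 <= t by rewrite divr_ge0 ?mulr_ge0 ?subr_ge0// ltW.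
set A := [set w | _].
have mA : measurable A.
  rewrite -[A]setTI; apply: measurable_fun_le => //.
  exact: measurable_sample_mean.
have mS : measurable_fun setT (fun w => (expR (t * sample_mean w))%:E : \bar R).
  apply/measurable_EFinP; apply: measurableT_comp => //.
  by apply: measurable_funM => //; exact: measurable_sample_mean.
rewrite -[A]setIT -integral_indic//.
apply: (@le_trans _ _
  (\int[P]_w ((expR (- (t * a)))%:E * (expR (t * sample_mean w))%:E))%E).
  apply: ge0_le_integral => //.
  - exact/measurable_EFinP.
  - exact: measurable_funeM.
  move=> w _; rewrite -EFinM -expRD lee_fin indicE.
  case: (boolP (w \in A)) => [|_]; last exact: expR_ge0.
  rewrite inE /A /= => aw; rewrite -[leLHS]expR0 ler_expR.
  by rewrite addrC subr_ge0 ler_wpM2l.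
rewrite ge0_integralZl_EFin ?expR_ge0//.
(* Regrouping exposes [s = t / (M N)], the parameter for [hierarchical_mgf_le]. *)
under eq_integral => w _ do rewrite mulrA.
apply: (le_trans (lee_wpmul2l _ (hierarchical_mgf_le _))) => //.
rewrite -EFinM -expRD lee_fin ler_expR le_eqVlt; apply/orP; left; apply/eqP.
rewrite /t natrM.
(* This is [v] with its denominator [N] cleared, the form in which [field] asks for it to be
   nonzero. *)
have vN : b1 ^+ 2 + b2 ^+ 2 * N%:R != 0.
  by rewrite gt_eqF// addr_gt0// ?mulr_gt0// exprn_gt0.
rewrite /v; field.
by rewrite vN !gt_eqF.
Qed.

End hierarchical_concentration.

(** * Union bound over the finite set [E] *)

Unset Implicit Arguments.

Theorem mainTheorem3 (R : realType) (dim : nat)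
  (d0 dx dy : measure_display) (Omega0 : measurableType d0)
  (TX : measurableType dx) (TY : measurableType dy)
  (P0 : probability Omega0 R) (X : Omega0 -> TX) (Y : Omega0 -> TY)
  (K : R.-pker TY ~> TX)
  (Theta : set 'rV[R]_dim) (g : 'rV[R]_dim -> TX -> TY -> R)
  (E : {fset 'rV[R]_dim}) (delta eps b1 b2 : R) :
  measurable_fun setT X -> measurable_fun setT Y ->
  is_cond_law P0 X Y K ->
  (forall th, th \in Theta ->
     measurable_fun setT (fun p : TX * TY => g th p.1 p.2)) ->
  (forall th, th \in Theta ->
     P0.-integrable setT (fun w => (g th (X w) (Y w))%:E)) ->
  (forall th, th \in E -> th \in Theta) ->
  E != fset0 ->
  0 < delta -> delta < eps ->
  (exists2 th, th \in E & ~ Seps (Gfun P0 X Y g) E eps th) ->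
  0 < b1 -> 0 < b2 ->
  (forall (t : R) th th', th \in E -> th' \in E ->
     {ae P0, forall w,
        (mgf_cond K g th th' t (Y w) <=
         (expR (condE_Gamma K g th th' (Y w) * t + b1 ^+ 2 * t ^+ 2 / 2))%:E)%E}) ->
  (forall (t : R) th th', th \in E -> th' \in E ->
     (\int[P0]_w (expR (t * condE_Gamma K g th th' (Y w)))%:E <=
      (expR (Rintegral P0 setT (fun w => Gamma g th th' (X w) (Y w)) * t
             + b2 ^+ 2 * t ^+ 2 / 2))%:E)%E) ->
  forall (M N : nat), (0 < M)%N -> (0 < N)%N ->
  forall (d : measure_display) (Omega : measurableType d) (P : probability Omega R)
    (Ys : 'I_M -> Omega -> TY) (Xs : 'I_M -> 'I_N -> Omega -> TX),
  hierarchical_sample P0 Y K P Ys Xs ->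
  (P [set w | ~ (Seps (fun th => Ghat Ys Xs g th w) E delta
                 `<=` Seps (Gfun P0 X Y g) E eps)]
   < ((#|` E|)%:R * expR (- (M%:R * (eps - delta) ^+ 2)
                     / (2 * (b1 ^+ 2 / N%:R + b2 ^+ 2))))%:E)%E.
Proof.
move=> mX mY _ mg ig EsubTh E0 delta0 deltaeps _ b10 b20 condmgf meanmgf
  M N M0 N0 d Omega P Ys Xs hs.
set q := expR _.
have v0 : 0 < b1 ^+ 2 / N%:R + b2 ^+ 2.
  by rewrite addr_gt0// ?divr_gt0// ?exprn_gt0// ltr0n.
have [mYs [mXs _]] := hs.
have mGhat th : th \in E -> measurable_fun setT (Ghat Ys Xs g th).
  move=> /EsubTh /mg mgth.
  exact: (measurable_sample_mean (c := g th) hs mgth).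
(* For [th] in [E], this is the event that [th] breaks the inclusion. Its first component does not
   depend on [w], so it is empty or the whole space. *)
pose A th := [set w | ~ Seps (Gfun P0 X Y g) E eps th] `&`
  \bigcap_(th' in [set` E])
    [set w | Ghat Ys Xs g th w <= Ghat Ys Xs g th' w + delta].
have mA th : th \in E -> measurable (A th).
  move=> thE; apply: measurableI.
    have [h|h] := pselect (Seps (Gfun P0 X Y g) E eps th).
      rewrite (_ : [set _ | _] = set0)//.
      by apply/seteqP; split => w //= /(_ h).
    by rewrite (_ : [set _ | _] = setT)//; apply/seteqP; split.
  apply: fin_bigcap_measurable => // th' th'E.
  rewrite -[X in measurable X]setTI; apply: measurable_fun_le => //.
    exact: mGhat.
  by apply: measurable_funD => //; exact: mGhat.
have PA th : th \in E -> (P (A th) < q%:E)%E.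
  move=> thE.
  have [thS|thNS] := pselect (Seps (Gfun P0 X Y g) E eps th).
    rewrite (_ : A th = set0) ?measure0 ?lte_fin ?expR_gt0//.
    by apply/seteqP; split => w // [/(_ thS)].
  have [th' th'E Gth'] : exists2 th', th' \in E &
      Gfun P0 X Y g th' + eps < Gfun P0 X Y g th.
    apply: contrapT => h; apply: thNS; split => // th' th'E.
    by rewrite leNgt; apply/negP => h'; apply: h; exists th'.
  have muE : Rintegral P0 setT (fun w => Gamma g th th' (X w) (Y w)) =
      Gfun P0 X Y g th' - Gfun P0 X Y g th.
    rewrite /Gamma RintegralB//; first exact: (ig _ (EsubTh _ th'E)).
    exact: (ig _ (EsubTh _ thE)).
  have mG : measurable_fun setT (fun p : TX * TY => Gamma g th th' p.1 p.2).
    exact: measurable_funB (mg _ (EsubTh _ th'E)) (mg _ (EsubTh _ thE)).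
  have mm : measurable_fun setT (condE_Gamma K g th th').
    exact: (measurable_Rintegral_kernel K mG).
  (* The threshold is [a = - delta], while the mean [G(th') - G(th)] lies strictly below [- eps];
     hence [a - mu > eps - delta > 0]. *)
  have := sample_mean_tail mY hs mG mm
    (fun t => condmgf t th th' thE th'E)
    (fun t => meanmgf t th th' thE th'E) (a := - delta) M0 N0 b10 b20.
  rewrite muE => /(_ _)/le_lt_trans tail.
  apply: (@le_lt_trans _ _ (P [set w | (- delta <= (M * N)%:R^-1 *
      \sum_(k < M) \sum_(l < N) Gamma g th th' (Xs k l w) (Ys k w))%R])).
    apply: le_measure; rewrite ?inE.
    - exact: mA.
    - rewrite -[X in measurable X]setTI; apply: measurable_fun_le => //.
      exact: (measurable_sample_mean (c := Gamma g th th') hs mG).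
    move=> w [_ /(_ th' th'E)] /=; rewrite /Ghat => h.
    rewrite /Gamma; under eq_bigr do rewrite sumrB.
    by rewrite sumrB mulrBr; lra.
  apply: tail; first by lra.
  (* The strict bound on the mean gives a strict inequality between the exponents. *)
  rewrite lte_fin ltr_expR !mulNr ltrN2 ltr_pM2r ?invr_gt0 ?mulr_gt0//.
  rewrite ltr_pM2l ?ltr0n// ltr_pXn2r ?nnegrE//; lra.
(* The union is indexed by the finite type of elements of [E], so that each index carries its
   membership proof. *)
have -> : [set w | ~ (Seps (fun th => Ghat Ys Xs g th w) E delta
      `<=` Seps (Gfun P0 X Y g) E eps)] = \big[setU/set0]_(th : E) A (val th).
  rewrite -bigcup_seq; apply/seteqP; split => w /=.
    move=> /existsNP[th /not_implyP[[thE thmin] thNS]].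
    exists [` thE]%fset; first by rewrite /= mem_index_enum.
    by split => // th' /= /thmin.
  move=> [th _ [thNS thmin]] sub; apply/thNS/sub; split; first exact: valP.
  by move=> th'; exact: thmin.
apply: (le_lt_trans (union_bound P _ _)) => [th|]; first exact: mA (valP th).
rewrite (eq_bigr (fun th : E => (fine (P (A (val th))))%:E)); last first.
  by move=> th _; rewrite fineK// fin_num_measure//; exact: mA (valP th).
rewrite sumEFin lte_fin.
have -> : (#|` E|)%:R * q = \sum_(th : E) q.
  by rewrite sumr_const cardfE mulr_natl.
(* Termwise strict bounds give a strict bound on the sums because [E] is not empty. *)
apply: ltr_sum.
  have /fset0Pn[th thE] := E0; apply/hasP.
  by exists [` thE]%fset => //; exact: mem_index_enum.
move=> th _; rewrite -lte_fin fineK; first exact: PA (valP th).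
by rewrite fin_num_measure//; exact: mA (valP th).
Qed.
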